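(* Let $n\ge4$ be even and let $\Phi_J=\begin{pmatrix}\cos(\pi/n)&\sin(\pi/n)&0\\-\sin(\pi/n)&\cos(\pi/n)&0\\0&0&1\end{pmatrix}$ be the maximally entangled state of the bipartite regular $n$-gon system. For every $\epsilon\in(0,1]$ there exist pure states $\omega_i,\omega_j$ of the $n$-gon such that the state $$W_\epsilon=\epsilon\,\Phi_J+(1-\epsilon)\,\omega_i\otimes\omega_j$$ exhibits Hardy nonlocality, i.e. there are measurements of the type described in the context such that on $W_\epsilon$ $$P(E_1^{A+},E_1^{B+})>0,\quad P(E_1^{A+},E_2^{B+})=0,\quad P(E_2^{A+},E_1^{B+})=0,\quad P(E_2^{A-},E_2^{B-})=0 .$$
   Context: Polygon model, $n$ even. Let $r_n=\sqrt{\sec(\pi/n)}$. The elementary state space $\Omega_n$ is the convex hull in $\mathbb R^3$ of the pure states $\omega_i=(r_n\cos\frac{2\pi i}{n},\,r_n\sin\frac{2\pi i}{n},\,1)^{\mathrm T}$, $i=1,\dots,n$. The unit effect is $u=(0,0,1)^{\mathrm T}$; the probability of an effect $e$ on a state $\omega$ is $e^{\mathrm T}\omega$, and the effects are all $e\in\mathbb R^3$ with $0\le e^{\mathrm T}\omega\le 1$ for all $\omega\in\Omega_n$. For even $n$ the extremal effects other than $0$ and $u$ are $e_i=\frac12(r_n\cos\frac{(2i-1)\pi}{n},\,r_n\sin\frac{(2i-1)\pi}{n},\,1)^{\mathrm T}$, $i=1,\dots,n$; write $\bar e_i=u-e_i$. Bipartite (maximal tensor product) states are the real $3\times3$ matrices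 $\Phi$ with $u^{\mathrm T}\Phi u=1$ and $e^{\mathrm T}\Phi f\ge 0$ for all effects $e,f$; the product state $\omega_i\otimes\omega_j$ is the matrix $\omega_i\omega_j^{\mathrm T}$. The joint probability of Alice's effect $E$ and Bob's effect $F$ on $\Phi$ is $P(E,F)=E^{\mathrm T}\Phi F$. Measurements used in Hardy's test: Alice has two different measurements $\{E_x^{A+},E_x^{A-}\}$, $x=1,2$, and Bob has two different measurements $\{E_y^{B+},E_y^{B-}\}$, $y=1,2$, each consisting of a pair $\{e_i,\bar e_i\}$ with either effect assigned the label $+$. (For $\epsilon<1$ the state $W_\epsilon$ is what the paper calls a ''mixed entangled state'': a convex mixture of a pure entangled state and a pure product state.) *)

(* Defs.v *)
From mathcomp Require Import all_boot all_order all_algebra.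
From mathcomp Require Import all_classical all_reals all_analysis.

Set Implicit Arguments.
Unset Strict Implicit.
Unset Printing Implicit Defensive.

Import Order.TTheory GRing.Theory Num.Theory.

Local Open Scope classical_set_scope.
Local Open Scope ring_scope.

Definition vec3 (R : realType) (x y z : R) : 'cV[R]_3 :=
  \col_k [:: x; y; z]`_k.

Definition polygon_radius (R : realType) (n : nat) : R :=
  Num.sqrt (cos (pi / n%:R))^-1.

Definition pure_state (R : realType) (n i : nat) : 'cV[R]_3 :=
  vec3 (polygon_radius R n * cos (2 * pi * i%:R / n%:R))
       (polygon_radius R n * sin (2 * pi * i%:R / n%:R))
       1.

(* The index is shifted: 'I_n starts at 0, the pure states at 1. *)
Definition state_space (R : realType) (n : nat) : set 'cV[R]_3 :=
  [set w | exists p : 'I_n -> R,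
     [/\ forall k, 0 <= p k, \sum_k p k = 1 &
         w = \sum_k p k *: pure_state R n k.+1]].

Definition unit_effect (R : realType) : 'cV[R]_3 := vec3 0 0 1.

Definition prob (R : realType) (e w : 'cV[R]_3) : R := (e^T *m w) 0 0.

Definition effect (R : realType) (n : nat) (e : 'cV[R]_3) : Prop :=
  forall w, state_space n w -> 0 <= prob e w <= 1.

(* These are the nontrivial extremal effects only when n is even. *)
Definition extremal_effect (R : realType) (n i : nat) : 'cV[R]_3 :=
  2^-1 *: vec3 (polygon_radius R n * cos ((2 * i%:R - 1) * pi / n%:R))
               (polygon_radius R n * sin ((2 * i%:R - 1) * pi / n%:R))
               1.

Definition joint_prob (R : realType) (Phi : 'M[R]_3) (E F : 'cV[R]_3) : R :=
  (E^T *m Phi *m F) 0 0.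

Definition bipartite_state (R : realType) (n : nat) (Phi : 'M[R]_3) : Prop :=
  joint_prob Phi (unit_effect R) (unit_effect R) = 1 /\
  forall e f, effect n e -> effect n f -> 0 <= joint_prob Phi e f.

Definition product_state (R : realType) (w v : 'cV[R]_3) : 'M[R]_3 := w *m v^T.

(* A labelled two-outcome measurement is a map from outcomes to effects, with
   [true] standing for the outcome + and [false] for the outcome -. *)
Definition polygon_measurement (R : realType) (n : nat) (E : bool -> 'cV[R]_3)
    : Prop :=
  exists2 i : nat, (1 <= i <= n)%N &
    let e := extremal_effect R n i in
    let ebar := unit_effect R - e in
    (E true = e /\ E false = ebar) \/ (E true = ebar /\ E false = e).

(* Two measurements are different when they differ as unordered pairs of
   effects: exchanging the labels + and - does not give a new measurement. *)
Definition different_measurements (R : realType) (E E' : bool -> 'cV[R]_3)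
    : Prop :=
  range E <> range E'.

Definition hardy_nonlocal (R : realType) (n : nat) (Phi : 'M[R]_3) : Prop :=
  exists A1 A2 B1 B2 : bool -> 'cV[R]_3,
    [/\ polygon_measurement n A1, polygon_measurement n A2 &
        different_measurements A1 A2] /\
    [/\ polygon_measurement n B1, polygon_measurement n B2 &
        different_measurements B1 B2] /\
    [/\ 0 < joint_prob Phi (A1 true) (B1 true),
        joint_prob Phi (A1 true) (B2 true) = 0,
        joint_prob Phi (A2 true) (B1 true) = 0 &
        joint_prob Phi (A2 false) (B2 false) = 0].

Definition PhiJ (R : realType) (n : nat) : 'M[R]_3 :=
  let c := cos (pi / n%:R) in
  let s := sin (pi / n%:R) in
  \matrix_(i, j) (nth [::] [:: [:: c; s; 0];
                               [:: - s; c; 0];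
                               [:: 0; 0; 1]] i)`_j.

Definition W_state (R : realType) (n : nat) (eps : R) (i j : nat)
    : 'M[R]_3 :=
  eps *: PhiJ R n
  + (1 - eps) *: product_state (pure_state R n i) (pure_state R n j).

(* Main.v *)
Require Import Defs.
From mathcomp Require Import all_boot all_order all_algebra.
From mathcomp Require Import all_classical all_reals all_analysis.
From mathcomp Require Import ring lra.

(** The witness is built from the first two extremal effects: take
    [i = 1], [j = 2], [A1 = (ubar e_2, e_2)], [A2 = (ubar e_1, e_1)],
    [B1 = (e_1, ubar e_1)] and [B2 = (e_2, ubar e_2)], where
    [ubar e = u - e] is the complement.  With [t = pi/n], the probabilities
    [(1 - cos ((2 a - 2 b + 1) t) / cos t) / 4] of [(ubar e_a, e_b)] and of
    [(e_a, ubar e_b)] on [PhiJ] vanish when [2 a - 2 b + 1] is [1] or [-1] and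
    are positive when it is [3], while [ubar e_1] and [ubar e_2] both vanish on
    [omega_1], and [ubar e_2] on [omega_2]: all three zeros survive the mixing.

    [PhiJ] is positive because it maps the dual cone of the polygon into the
    cone over the polygon.  For [f = (p, z)] nonnegative on the polygon, choose
    [k] maximizing the inner product of [p] with the direction of [omega_k].
    Comparison with the two neighbours of [omega_k] puts [p] in the cone
    spanned by the two directions at angle [t] from it, and nonnegativity of
    [f] at the vertex opposite to [omega_k] bounds [z] from below. *)

Set Implicit Arguments.
Unset Strict Implicit.
Unset Printing Implicit Defensive.

Import Order.TTheory GRing.Theory Num.Theory.
Local Open Scope ring_scope.

(** * Coordinate formulas for single and joint probabilities *)

Section Coordinates.
Context {R : realType}.
Implicit Types (x y z : R) (e f w v : 'cV[R]_3) (n : nat).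

Lemma vec3_eta v : exists x y z, v = vec3 x y z.
Proof.
exists (v ord0 0), (v (lift ord0 ord0) 0), (v (lift ord0 (lift ord0 ord0)) 0).
apply/colP => i; rewrite mxE.
case: i => [[|[|[|i]]] Hi] //=; congr (v _ _); exact/val_inj.
Qed.

Lemma prob_vec3 x y z x' y' z' :
  prob (vec3 x y z) (vec3 x' y' z') = x * x' + y * y' + z * z'.
Proof.
by rewrite /prob mxE !big_ord_recl big_ord0 !mxE /= addr0 addrA.
Qed.

(** The planar block of [PhiJ] is the rotation by [- pi / n], hence an inner product and a cross
    product. *)
Lemma joint_prob_PhiJ n x y z x' y' z' :
  joint_prob (PhiJ R n) (vec3 x y z) (vec3 x' y' z') =
  cos (pi / n%:R) * (x * x' + y * y') + sin (pi / n%:R) * (x * y' - y * x')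
  + z * z'.
Proof.
rewrite /joint_prob mxE !big_ord_recl big_ord0 !mxE !big_ord_recl !big_ord0.
by rewrite !mxE /=; ring.
Qed.

Lemma joint_prob_product w v e f :
  joint_prob (product_state w v) e f = prob e w * prob f v.
Proof.
rewrite /joint_prob /product_state mulmxA -mulmxA mxE big_ord1.
by congr (_ * _); rewrite -[v^T *m f]trmxK mxE trmx_mul trmxK.
Qed.

Lemma joint_prob_W n (eps : R) i j e f :
  joint_prob (W_state n eps i j) e f =
  eps * joint_prob (PhiJ R n) e f +
  (1 - eps) * (prob e (pure_state R n i) * prob f (pure_state R n j)).
Proof.
rewrite -joint_prob_product /joint_prob /W_state.
by rewrite mulmxDr mulmxDl -!scalemxAr -!scalemxAl !mxE.
Qed.

Lemma extremal_effectE n i :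
  extremal_effect R n i =
  vec3 (2^-1 * (polygon_radius R n * cos ((2 * i%:R - 1) * (pi / n%:R))))
       (2^-1 * (polygon_radius R n * sin ((2 * i%:R - 1) * (pi / n%:R)))) 2^-1.
Proof.
apply/colP => -[[|[|[|k]]] Hk] //; rewrite !mxE /= ?mulr1 //.
all: by rewrite [_ * (pi / _)]mulrA.
Qed.

Lemma vec3B x y z x' y' z' :
  vec3 x y z - vec3 x' y' z' = vec3 (x - x') (y - y') (z - z').
Proof. by apply/colP => -[[|[|[|k]]] Hk] //; rewrite !mxE. Qed.

Lemma pure_stateE n i :
  pure_state R n i =
  vec3 (polygon_radius R n * cos (2 * i%:R * (pi / n%:R)))
       (polygon_radius R n * sin (2 * i%:R * (pi / n%:R))) 1.
Proof.
rewrite /pure_state.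
by have -> : 2 * pi * i%:R / n%:R = 2 * i%:R * (pi / n%:R) :> R by ring.
Qed.

End Coordinates.

Lemma rotated_height {R : realType} (x y T d : R) :
  x * cos (T + d) + y * sin (T + d) =
  (x * cos T + y * sin T) * cos d + (y * cos T - x * sin T) * sin d.
Proof. by rewrite cosD sinD; ring. Qed.

(* In coordinates rotated by the direction of the maximizing vertex, [(m, l)]
   and [(p, q)] are the planar parts of the two effects, [z] and [c] their last
   coordinates.  The hypotheses are, in order: maximality against the two
   neighbouring vertices, nonnegativity of the first effect at the opposite
   vertex, and nonnegativity of the second one at the maximizing vertex and at
   its predecessor. *)
Lemma rotated_PhiJ_ge0 {R : realType} (u v r m l z p q c : R) :
  0 < u -> 0 < v -> 0 < r -> u ^+ 2 + v ^+ 2 = 1 -> r ^+ 2 * u = 1 ->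
  m * (u ^+ 2 - v ^+ 2) + l * (2 * u * v) <= m ->
  m * (u ^+ 2 - v ^+ 2) - l * (2 * u * v) <= m ->
  r * m <= z -> 0 <= r * p + c ->
  0 <= r * (p * (u ^+ 2 - v ^+ 2) - q * (2 * u * v)) + c -> 0 <= c ->
  0 <= u * (p * m + q * l) + v * (p * l - q * m) + c * z.
Proof.
move=> u0 v0 r0 uv ru hl hr hz E1 E0 c0.
have u2 : u ^+ 2 = 1 - v ^+ 2 by rewrite -uv addrK.
(* Up to the factor [2 * u * v], [m * v - l * u] and [m * v + l * u] are the coefficients of
   [(m, l)] on [(u, - v)] and [(u, v)]. *)
have A0 : 0 <= m * v - l * u.
  have v20 : 0 < 2 * v by rewrite mulr_gt0.
  rewrite -(pmulr_rge0 _ v20).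
  have -> : 2 * v * (m * v - l * u) =
    m - (m * (u ^+ 2 - v ^+ 2) + l * (2 * u * v)) by rewrite u2; ring.
  by rewrite subr_ge0.
have B0 : 0 <= m * v + l * u.
  have v20 : 0 < 2 * v by rewrite mulr_gt0.
  rewrite -(pmulr_rge0 _ v20).
  have -> : 2 * v * (m * v + l * u) =
    m - (m * (u ^+ 2 - v ^+ 2) - l * (2 * u * v)) by rewrite u2; ring.
  by rewrite subr_ge0.
have k0 : 0 < 2 * u * v * r by rewrite !mulr_gt0.
rewrite -(pmulr_rge0 _ k0).
(* [PhiJ] turns [(u, v)] to the maximizing vertex and [(u, - v)] to its predecessor, where the
   second effect is nonnegative. *)
have -> : 2 * u * v * r * (u * (p * m + q * l) + v * (p * l - q * m) + c * z) =
  (m * v - l * u) * (r * (p * (u ^+ 2 - v ^+ 2) - q * (2 * u * v)) + c) +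
  (m * v + l * u) * (r * p + c) + 2 * u * v * r * (c * (z - r * m)).
  have -> : 2 * u * v * r * (c * (z - r * m)) =
    2 * u * v * r * c * z - 2 * v * c * m * (r ^+ 2 * u) by ring.
  have -> : r * p + c = r * p * (u ^+ 2 + v ^+ 2) + c by rewrite uv mulr1.
  by rewrite ru; ring.
by rewrite !addr_ge0 // mulr_ge0 // ?(ltW k0) // mulr_ge0 // subr_ge0.
Qed.

(** * The regular polygon: angular step and radius *)

Section Polygon.
Context {R : realType} (n : nat) (n_ge4 : (4 <= n)%N).
Implicit Types (e f : 'cV[R]_3) (x y z : R) (i j k : nat).

Let t : R := pi / n%:R.
Let r : R := polygon_radius R n.

Let n_gt0 : 0 < n%:R :> R.
Proof. by rewrite ltr0n (leq_trans _ n_ge4). Qed.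

Lemma step_gt0 : 0 < t.
Proof. by rewrite divr_gt0 ?pi_gt0. Qed.

Lemma step_le : 4 * t <= pi.
Proof.
rewrite /t mulrCA ler_piMr ?pi_ge0 // ler_pdivrMr // mul1r.
by rewrite (ler_nat R 4 n).
Qed.

Lemma cos_step_gt0 : 0 < cos t.
Proof.
have t0 := step_gt0; have t4 := step_le.
by apply: cos_gt0_pihalf; apply/andP; split; lra.
Qed.

Lemma sin_step_gt0 : 0 < sin t.
Proof.
by have t0 := step_gt0; have t4 := step_le; apply: sin_gt0_pi; lra.
Qed.

Lemma sin_2step_gt0 : 0 < sin (2 * t).
Proof.
rewrite mulrC mulr_natr sin_mulr2n pmulrn_lgt0 //.
by rewrite mulr_gt0 ?cos_step_gt0 ?sin_step_gt0.
Qed.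

(** Since [4 <= n], the angle [3 * t] stays in [[0, pi]], where the cosine strictly decreases. *)
Lemma cos_3step_lt : cos (3 * t) < cos t.
Proof.
have t0 := step_gt0; have t4 := step_le.
by rewrite ltr_cos ?in_itv /=; lra.
Qed.

Lemma radius_sqr : r ^+ 2 = (cos t)^-1.
Proof. by rewrite sqr_sqrtr // invr_ge0 ltW // cos_step_gt0. Qed.

Lemma radius_gt0 : 0 < r.
Proof. by rewrite sqrtr_gt0 invr_gt0 cos_step_gt0. Qed.

(** * Closed forms for the extremal effects; [r ^+ 2] appears as [1 / cos t] *)

Lemma prob_complement_pure i j :
  prob (unit_effect R - extremal_effect R n i) (pure_state R n j) =
  (1 - cos ((2 * i%:R - 1 - 2 * j%:R) * t) / cos t) / 2.
Proof.
rewrite /unit_effect extremal_effectE pure_stateE vec3B prob_vec3 -/t -/r.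
rewrite [(_ - 2 * j%:R) * t]mulrBl cosB -radius_sqr.
by field.
Qed.

Lemma joint_prob_PhiJ_complementl i j :
  joint_prob (PhiJ R n) (unit_effect R - extremal_effect R n i)
             (extremal_effect R n j) =
  (1 - cos ((2 * i%:R - 2 * j%:R + 1) * t) / cos t) / 4.
Proof.
rewrite /unit_effect !extremal_effectE vec3B joint_prob_PhiJ -/t -/r.
have -> : (2 * i%:R - 2 * j%:R + 1) * t =
  ((2 * i%:R - 1) * t - (2 * j%:R - 1) * t) + t by ring.
by rewrite cosD cosB sinB -radius_sqr; field.
Qed.

Lemma joint_prob_PhiJ_complementr i j :
  joint_prob (PhiJ R n) (extremal_effect R n i)
             (unit_effect R - extremal_effect R n j) =
  (1 - cos ((2 * i%:R - 2 * j%:R + 1) * t) / cos t) / 4.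
Proof.
rewrite /unit_effect !extremal_effectE vec3B joint_prob_PhiJ -/t -/r.
have -> : (2 * i%:R - 2 * j%:R + 1) * t =
  ((2 * i%:R - 1) * t - (2 * j%:R - 1) * t) + t by ring.
by rewrite cosD cosB sinB -radius_sqr; field.
Qed.

(** * Periodicity of the vertices and positivity of [PhiJ] *)

Lemma pure_state_modn k : pure_state R n k = pure_state R n (k %% n).
Proof.
rewrite {1}(divn_eq k n) !pure_stateE natrD natrM.
have -> : 2 * ((k %/ n)%:R * n%:R + (k %% n)%:R) * (pi / n%:R) =
  2 * (k %% n)%:R * (pi / n%:R) + pi *+ (k %/ n).*2 :> R.
  by rewrite -[pi *+ _]mulr_natr -muln2 natrM; field; rewrite gt_eqF.
rewrite (alternatingn (@cosDpi R)) (alternatingn (@sinDpi R)).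
by rewrite -signr_odd odd_double !mul1r.
Qed.

Lemma pure_state_ord k : exists i : 'I_n, pure_state R n k = pure_state R n i.+1.
Proof.
have n0 : (0 < n)%N by exact: leq_trans n_ge4.
(* Modulo [n] this is [k - 1], which undoes the index shift, also for [k = 0]. *)
exists (Ordinal (ltn_pmod (k + n.-1) n0)) => /=.
rewrite pure_state_modn [RHS]pure_state_modn; congr pure_state.
by rewrite -addn1 modnDml addn1 -addnS prednK // modnDr.
Qed.

Lemma effect_pure_ge0 e k : effect n e -> 0 <= prob e (pure_state R n k).
Proof.
move=> eff; have [i ->] := pure_state_ord k.
have /eff/andP[] // : state_space n (pure_state R n i.+1).
exists (fun j : 'I_n => (j == i)%:R); split => [j||].
- by rewrite ler0n.
- rewrite (bigD1 i) //= eqxx big1 => [|j /negPf -> //].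
  by rewrite addr0.
rewrite (bigD1 i) //= eqxx scale1r big1 => [|j /negPf ->].
  by rewrite addr0.
by rewrite scale0r.
Qed.

Let height x y k := x * cos (2 * k%:R * t) + y * sin (2 * k%:R * t).

Lemma prob_pure x y z k :
  prob (vec3 x y z) (pure_state R n k) = r * height x y k + z.
Proof. by rewrite pure_stateE prob_vec3 /height -/t -/r; ring. Qed.

(** By periodicity finitely many vertices suffice. Writing the maximizer as [k.+1] gives it the
    predecessor [k] without modular arithmetic. *)
Lemma height_max x y : exists k, forall j, height x y j <= height x y k.+1.
Proof.
have n0 : (0 < n)%N by exact: leq_trans n_ge4.
have heightE a b : pure_state R n a = pure_state R n b ->
    height x y a = height x y b.
  move=> /(congr1 (prob (vec3 x y 0))); rewrite !prob_pure !addr0.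
  by apply: mulfI; rewrite gt_eqF ?radius_gt0.
case: (@Order.TotalTheory.arg_maxP _ R 'I_n (Ordinal n0) xpredT
         (fun i : 'I_n => height x y i.+1) isT) => i _ imax.
exists i => j.
have [a /heightE ->] := pure_state_ord j.
exact: imax.
Qed.

Lemma prob_pure_opposite x y z k : ~~ odd n ->
  prob (vec3 x y z) (pure_state R n (k + n./2)) = - (r * height x y k) + z.
Proof.
move=> n_even; rewrite prob_pure /height.
have -> : 2 * (k + n./2)%:R * t = 2 * k%:R * t + pi.
  have nE : n%:R = 2 * n./2%:R :> R.
    by rewrite -natrM mul2n even_halfK.
  by rewrite natrD mulrDr mulrDl -nE /t [n%:R * _]mulrC divfK ?gt_eqF.
by rewrite cosDpi sinDpi; ring.
Qed.

Lemma joint_prob_PhiJ_ge0 e f : ~~ odd n -> effect n e -> effect n f ->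
  0 <= joint_prob (PhiJ R n) e f.
Proof.
move=> n_even eff_e eff_f.
have [a [b [c ee]]] := vec3_eta e; have [x [y [z ef]]] := vec3_eta f.
rewrite {}ee in eff_e *; rewrite {}ef in eff_f *.
have [k kmax] := height_max x y.
(* The values at two opposite vertices add up to [2 * c]. *)
have c_ge0 : 0 <= c.
  have := effect_pure_ge0 0 eff_e; have := effect_pure_ge0 (0 + n./2) eff_e.
  by rewrite prob_pure_opposite // prob_pure; lra.
have := effect_pure_ge0 (k.+1 + n./2) eff_f.
rewrite prob_pure_opposite // => z_ge.
have := effect_pure_ge0 k.+1 eff_e; rewrite prob_pure => Ek1.
have := effect_pure_ge0 k eff_e; rewrite prob_pure => Ek.
have kp := kmax k.+2; have km := kmax k.
have s0 := sin_step_gt0; have c0 := cos_step_gt0; have r0 := radius_gt0.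
have rr : r ^+ 2 * cos t = 1 by rewrite radius_sqr mulVf // gt_eqF.
rewrite joint_prob_PhiJ -/t.
move: kp km z_ge Ek1 Ek; rewrite /height.
set T := 2 * k.+1%:R * t.
have -> : 2 * k.+2%:R * t = T + 2 * t by rewrite /T -[k.+2%:R]natr1; ring.
have -> : 2 * k%:R * t = T + - (2 * t) by rewrite /T -[k.+1%:R]natr1; ring.
rewrite !rotated_height cosN sinN.
have -> : 2 * t = t + t by ring.
rewrite cosD sinD.
have uv := cos2Dsin2 t; have CS := cos2Dsin2 T.
(* Inner and cross products are unchanged when both planar parts are rotated by [- T]. *)
have -> : cos t * (a * x + b * y) + sin t * (a * y - b * x) =
  cos t * ((a * cos T + b * sin T) * (x * cos T + y * sin T) +
           (b * cos T - a * sin T) * (y * cos T - x * sin T)) +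
  sin t * ((a * cos T + b * sin T) * (y * cos T - x * sin T) -
           (b * cos T - a * sin T) * (x * cos T + y * sin T)).
  transitivity ((cos T ^+ 2 + sin T ^+ 2) *
    (cos t * (a * x + b * y) + sin t * (a * y - b * x))); last by ring.
  by rewrite CS mul1r.
move=> kp km z_ge Ek1 Ek.
apply: (rotated_PhiJ_ge0 c0 s0 r0) => //; lra.
Qed.

(* The functional [prob _ w] with [w] orthogonal to the direction of [e_1]
   separates [e_2] from [e_1] and from its complement. *)
Lemma extremal_effect2_neq :
  extremal_effect R n 2 <> extremal_effect R n 1 /\
  extremal_effect R n 2 <> unit_effect R - extremal_effect R n 1.
Proof.
pose w := vec3 (- sin t) (cos t) 0.
have w2 : 0 < prob (extremal_effect R n 2) w.
  rewrite extremal_effectE prob_vec3 -/t -/r.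
  have -> : (2 * 2 - 1) * t = 2 * t + t by ring.
  rewrite cosD sinD.
  have -> : 2^-1 * (r * (cos (2 * t) * cos t - sin (2 * t) * sin t)) * - sin t +
    2^-1 * (r * (sin (2 * t) * cos t + cos (2 * t) * sin t)) * cos t +
    2^-1 * 0 = 2^-1 * (r * (sin (2 * t) * (cos t ^+ 2 + sin t ^+ 2))) by ring.
  by rewrite cos2Dsin2 mulr1 !mulr_gt0 ?invr_gt0 ?radius_gt0 ?sin_2step_gt0.
have tE : (2 * 1 - 1) * t = t by ring.
by split=> e21; move: w2; rewrite e21 /unit_effect extremal_effectE ?vec3B
  prob_vec3 -/t -/r tE lt_neqAle => /andP[/eqP[]]; ring.
Qed.

End Polygon.

Theorem theorem4 (R : realType) (n : nat) (n_ge4 : (4 <= n)%N)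
    (n_even : ~~ odd n) (eps : R) (eps_gt0 : 0 < eps) (eps_le1 : eps <= 1) :
  exists i j : nat,
    [/\ (1 <= i <= n)%N, (1 <= j <= n)%N,
        bipartite_state n (W_state n eps i j) &
        hardy_nonlocal n (W_state n eps i j)].
Proof.
have n_ge2 : (1 < n)%N by exact: leq_trans n_ge4.
have n_ge1 : (0 < n)%N by exact: leq_trans n_ge4.
exists 1, 2; split => //.
  split.
    rewrite joint_prob_W /unit_effect joint_prob_PhiJ !pure_stateE !prob_vec3.
    by ring.
  move=> e f eff_e eff_f; rewrite joint_prob_W.
  rewrite addr_ge0 // mulr_ge0 ?subr_ge0 ?(ltW eps_gt0) //.
    exact: joint_prob_PhiJ_ge0.
  by rewrite mulr_ge0 // effect_pure_ge0.
set e1 := extremal_effect R n 1; set e2 := extremal_effect R n 2.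
pose meas (e f : 'cV[R]_3) (b : bool) := if b then e else f.
exists (meas (unit_effect R - e2) e2), (meas (unit_effect R - e1) e1),
  (meas e1 (unit_effect R - e1)), (meas e2 (unit_effect R - e2)).
have c_neq0 : cos (pi / n%:R) != 0 :> R by rewrite gt_eqF ?cos_step_gt0.
have e2_neq1 : e2 <> e1 /\ e2 <> unit_effect R - e1.
  exact: extremal_effect2_neq.
split; [split|split; [split|]].
- by exists 2%N; rewrite ?n_ge2 //; right.
- by exists 1%N; rewrite ?n_ge1 //; right.
(* Equal ranges would make [e2] equal to [e1] or to its complement. *)
- move=> rng; have : range (meas (unit_effect R - e2) e2) e2 by exists false.
  by rewrite rng => -[[] _ /= /esym]; case: e2_neq1.
- by exists 1%N; rewrite ?n_ge1 //; left.
- by exists 2%N; rewrite ?n_ge2 //; left.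
- move=> rng; have : range (meas e2 (unit_effect R - e2)) e2 by exists true.
  by rewrite -rng => -[[] _ /= /esym]; case: e2_neq1.
rewrite !joint_prob_W /meas /e1 /e2.
have angle (a : R) : a = 1 \/ a = -1 ->
    1 - cos (a * (pi / n%:R)) / cos (pi / n%:R) = 0.
  by case=> ->; rewrite ?mulN1r ?cosN ?mul1r divff ?subrr.
split; rewrite ?joint_prob_PhiJ_complementl ?joint_prob_PhiJ_complementr
  ?prob_complement_pure //.
- rewrite (angle (2 * 2 - 1 - 2 * 1)); last by left; ring.
  (* The product term vanishes, so positivity rests on [eps > 0] and the angle [3 * t] in the
     entangled part. *)
  rewrite !mul0r mulr0 addr0 mulr_gt0 // divr_gt0 //.
  have -> : (2 * 2 - 2 * 1 + 1) * (pi / n%:R) = 3 * (pi / n%:R) :> R by ring.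
  by rewrite subr_gt0 ltr_pdivrMr ?cos_step_gt0 // mul1r cos_3step_lt.
- rewrite (angle (2 * 2 - 1 - 2 * 1)); last by left; ring.
  rewrite (angle (2 * 2 - 2 * 2 + 1)); last by left; ring.
  by ring.
- rewrite (angle (2 * 1 - 1 - 2 * 1)); last by right; ring.
  rewrite (angle (2 * 1 - 2 * 1 + 1)); last by left; ring.
  by ring.
- rewrite (angle (2 * 2 - 1 - 2 * 2)); last by right; ring.
  rewrite (angle (2 * 1 - 2 * 2 + 1)); last by right; ring.
  by ring.
Qed.
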